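(* Let $R=\bigoplus_{n\in\mathbb{Z}}R_n$ be a $\mathbb{Z}$-graded ring. Suppose that $R$ contains a maximal (two-sided) ideal $M$ such that $(M)_h=0$, where $(M)_h$ denotes the largest homogeneous ideal of $R$ contained in $M$. Then the graded pseudoradical of $R$ is nonzero.
   Context: All rings are associative with identity, not necessarily commutative; ''ideal'' means two-sided ideal. A $\mathbb{Z}$-graded ring is a ring $R$ with a decomposition $R=\bigoplus_{n\in\mathbb{Z}}R_n$ into additive subgroups such that $R_nR_m\subseteq R_{n+m}$ for all $n,m\in\mathbb{Z}$. An ideal $I$ of $R$ is homogeneous if $I=\bigoplus_{n\in\mathbb{Z}}(I\cap R_n)$. A homogeneous ideal $P$ of $R$ is graded prime if, for arbitrary homogeneous ideals $I,J$ of $R$, $IJ\subseteq P$ implies $I\subseteq P$ or $J\subseteq P$. The graded pseudoradical of $R$ is the intersection of all nonzero graded prime ideals of $R$; the empty intersection is, by definition, equal to $R$. *)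

(* Defs.v *)
From HB Require Import structures.
From mathcomp Require Import all_boot all_order all_algebra.
From mathcomp Require Import mathcomp_extra boolp classical_sets functions.
From mathcomp Require Import cardinality fsbigop.

Set Implicit Arguments.
Unset Strict Implicit.
Unset Printing Implicit Defensive.

Import GRing.Theory.

Local Open Scope classical_set_scope.
Local Open Scope ring_scope.

Section InternalDirectSum.
Variable V : zmodType.
Implicit Types (A : set V) (B : int -> set V) (c : int -> V).

Definition additive_subgroup A : Prop := zmod_closed [in A].

(* The finiteness clause is essential: a [\sum_(n \in setT) c n] with infinite
   support is 0 by convention. *)
Definition finite_selection B c : Prop :=
  (forall n, B n (c n)) /\ finite_set [set n | c n != 0].

Definition sum_of_subgroups B : set V :=
  [set x | exists2 c, finite_selection B c & x = \sum_(n \in setT) c n].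

Definition independent_subgroups B : Prop :=
  forall c, finite_selection B c -> \sum_(n \in setT) c n = 0 ->
  forall n, c n = 0.

Definition internal_direct_sum B A : Prop :=
  sum_of_subgroups B = A /\ independent_subgroups B.

End InternalDirectSum.

(* Rings are [pzRingType]s: the trivial ring is not excluded. *)
Section Ideals.
Variable R : pzRingType.
Implicit Types (I J M : set R).

Definition two_sided_ideal I : Prop :=
  additive_subgroup I /\ forall r x, I x -> I (r * x) /\ I (x * r).

Definition ideal_mul I J : set R :=
  [set x | exists2 s : seq (R * R),
     (forall p, p \in s -> I p.1 /\ J p.2) & x = \sum_(p <- s) p.1 * p.2].

Definition maximal_ideal M : Prop :=
  [/\ two_sided_ideal M, M <> setT &
      forall I, two_sided_ideal I -> M `<=` I -> I = M \/ I = setT].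

End Ideals.

Section Graded.
Variables (R : pzRingType) (G : int -> set R).
Implicit Types (I J P H M : set R).

Definition Z_grading : Prop :=
  [/\ forall n, additive_subgroup (G n),
      internal_direct_sum G setT &
      forall n m x y, G n x -> G m y -> G (n + m) (x * y)].

Definition homogeneous_ideal I : Prop :=
  two_sided_ideal I /\ internal_direct_sum (fun n => I `&` G n) I.

(* [H] is $(M)_h$. *)
Definition largest_homogeneous_ideal_in M H : Prop :=
  [/\ homogeneous_ideal H, H `<=` M &
      forall I, homogeneous_ideal I -> I `<=` M -> I `<=` H].

(* [P] is not required to be proper; allowing [P = setT] does not change the
   intersection below. *)
Definition graded_prime P : Prop :=
  homogeneous_ideal P /\
  forall I J, homogeneous_ideal I -> homogeneous_ideal J ->
    ideal_mul I J `<=` P -> I `<=` P \/ J `<=` P.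

Definition graded_pseudoradical : set R :=
  \bigcap_(P in [set P | graded_prime P /\ P <> [set 0]]) P.

End Graded.

(* Main.v *)
Require Import Defs.
From HB Require Import structures.
From mathcomp Require Import all_boot all_order all_algebra.
From mathcomp Require Import mathcomp_extra boolp classical_sets functions.
From mathcomp Require Import cardinality fsbigop.
From mathcomp Require Import zify.

Set Implicit Arguments.
Unset Strict Implicit.
Unset Printing Implicit Defensive.

Import GRing.Theory.

Local Open Scope classical_set_scope.
Local Open Scope ring_scope.

(** The proof is a division argument, like the one that puts the leading
    coefficient of a polynomial of minimal degree in a maximal ideal of [A[X]],
    for a commutative ring [A] that this ideal meets in [0], into every nonzero
    prime ideal of [A].

    A nonzero homogeneous ideal [I] is not contained in [M], so [I + M = R]
    ([maximal_comaximal]).  In particular a product of two nonzero homogeneous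
    ideals contains an element congruent to [1] modulo [M], so [0] is graded
    prime ([graded_prime0]).

    If [M = 0], the same fact says that every nonzero homogeneous ideal is [R].
    Otherwise let [m] be a nonzero element of [M] whose support spans the
    smallest possible interval of degrees, [p .. p + n], with extreme components
    [a] (degree [p + n]) and [b] (degree [p]).  Here [n > 0], as [M] contains no
    nonzero homogeneous element.  The claim is that every nonzero graded prime
    [P] contains [a] or [b] ([shortest_in_prime]); it then contains every
    [a * r * b], and since [0] is graded prime some [a * r * b] is nonzero.

    For the claim, minimality gives the commutation rule [a * r * m = m * r * a]
    for homogeneous [r] ([shortest_top_comm]), which makes it possible to divide
    elements of [M] by [m] in spite of noncommutativity: if [a] is not in [P],
    then each [f] in [M] has a homogeneous [h] outside [P] and a [g] such that
    [a * r * h * f = m * r * g] for all homogeneous [r] ([shortest_division]).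
    The point is that [g] does not depend on [r].  Take [f] in [M] congruent to
    [1] modulo [P].  Then [m * r * g] is homogeneous modulo [P], congruent to
    [a * r * h], for all homogeneous [r].  If neither [a] nor [b] is in [P], graded
    primeness provides [r] for which the top component of [m * r * g] modulo
    [P] is [a * r] times that of [g], and another [r] for which the bottom one
    is [b * r] times that of [g].  Both have to sit in the degree of
    [a * r * h], so the lowest degree of [g] modulo [P] exceeds the highest one
    by [n > 0], which is absurd. *)

(** * Subgroups, ideals and finitely supported sums *)

Section Subgroups.
Variables (V : zmodType) (A : set V).
Hypothesis subA : additive_subgroup A.

Lemma subgroup0 : A 0.
Proof. by have [/set_mem] := subA. Qed.

Lemma subgroupB x y : A x -> A y -> A (x - y).
Proof.
by move=> Ax Ay; have [_ AB] := subA; apply/set_mem/AB; apply/mem_set.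
Qed.

Lemma subgroupN x : A x -> A (- x).
Proof.
by move=> Ax; rewrite -sub0r; apply: subgroupB => //; apply: subgroup0.
Qed.

Lemma subgroupD x y : A x -> A y -> A (x + y).
Proof. by move=> Ax Ay; rewrite -(opprK y); apply/subgroupB/subgroupN. Qed.

Lemma subgroup_sum (I : eqType) (s : seq I) (F : I -> V) :
  (forall i, i \in s -> A (F i)) -> A (\sum_(i <- s) F i).
Proof.
move=> AF; rewrite big_seq; elim/big_ind: _ => //; first exact: subgroup0.
exact: subgroupD.
Qed.

End Subgroups.

Lemma subgroupI (V : zmodType) (A : set V) :
  A 0 -> (forall x y, A x -> A y -> A (x - y)) -> additive_subgroup A.
Proof.
move=> A0 AB; split; first exact: mem_set.
by move=> x y /set_mem Ax /set_mem Ay; apply/mem_set/AB.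
Qed.

Lemma ideal_proper_1 (R : pzRingType) (I : set R) :
  two_sided_ideal I -> I 1 -> I = setT.
Proof.
move=> [_ IM] I1; apply/seteqP; split=> // x _.
by rewrite -(mulr1 x); case: (IM x 1 I1).
Qed.

Lemma fsum_seq (V : zmodType) (c : int -> V) (s : seq int) :
  uniq s -> (forall n, n \notin s -> c n = 0) ->
  \sum_(n \in setT) c n = \sum_(n <- s) c n.
Proof.
move=> us c0; rewrite (fsbigE s) //; last by move=> i _; apply: c0.
by apply: eq_bigl => i; rewrite in_setT.
Qed.

Lemma finite_selectionP (V : zmodType) (B : int -> set V) (c : int -> V) :
  finite_selection B c <->
  (forall n, B n (c n)) /\
  exists s, uniq s /\ forall n, n \notin s -> c n = 0.
Proof.
split=> -[Bc fc]; split=> //.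
  have [s es] := (finite_seqP _).1 fc.
  exists (undup s); split=> [|n]; first exact: undup_uniq.
  rewrite mem_undup => ns; apply/eqP; apply: contraNT ns => cn.
  by have : [set` s] n by rewrite -es.
case: fc => s [_ s0]; apply: (sub_finite_set _ (finite_seq s)) => n /= cn.
by apply: contraNT cn => /s0 ->.
Qed.

Lemma finite_extremes (Q : int -> Prop) (s : seq int) :
  (exists i, Q i) -> (forall i, Q i -> i \in s) ->
  exists t u, [/\ Q t, Q u & forall i, Q i -> u <= i <= t].
Proof.
elim: s Q => [|k s IHs] Q; first by move=> [i Qi] /(_ i Qi).
move=> exQ Qs; pose Q' i := Q i /\ i != k.
have [exQ'|noQ'] := pselect (exists i, Q' i); last first.
  have Qk i : Q i -> i = k.
    move=> Qi; apply/eqP; apply: contrapT => /negP ik.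
    by apply: noQ'; exists i.
  case: exQ => i Qi; have ik := Qk i Qi; exists k, k.
  by split; rewrite -?ik // => j /Qk ->; lia.
have [i [Qi ik]|t [u [[Qt _] [Qu _] tu]]] := IHs Q' exQ'.
  by have := Qs i Qi; rewrite inE (negPf ik).
have [Qk|nQk] := pselect (Q k); last first.
  exists t, u; split=> // i Qi; apply: tu; split=> //.
  by apply/eqP => ik; apply: nQk; rewrite -ik.
exists (if k <= t then t else k), (if u <= k then u else k).
split; [by case: ifP|by case: ifP|move=> i Qi].
have [->|ik] := eqVneq i k; first by case: ifP; case: ifP; lia.
by have := tu i (conj Qi ik); case: ifP; case: ifP; lia.
Qed.

(** * Homogeneous components *)

(** The decomposition of [x] is picked by choice; [componentE] is the
    uniqueness that makes the choice immaterial. *)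
Definition component (R : pzRingType) (G : int -> set R) (x : R) : int -> R :=
  xget (fun=> 0)
    [set c | finite_selection G c /\ x = \sum_(n \in setT) c n].

Section Components.
Variables (R : pzRingType) (G : int -> set R).
Hypothesis grG : Z_grading G.
Implicit Types (x y u g : R) (i k n e : int).
Local Notation "x `_[ i ]" := (component G x i)
  (at level 2, i at level 200, format "x `_[ i ]").

Lemma piece_subgroup n : additive_subgroup (G n).
Proof. by case: grG. Qed.

Lemma component_selection x :
  finite_selection G (component G x) /\ x = \sum_(n \in setT) x`_[n].
Proof.
have [_ [sumG _] _] := grG.
have /= : [set c | finite_selection G c /\ x = \sum_(n \in setT) c n]
            (component G x); last by [].
apply: xgetPex; have : [set: R] x by [].
by rewrite -sumG => -[c selc ->]; exists c.
Qed.

Lemma component_in x n : G n x`_[n].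
Proof. by have [[]] := component_selection x. Qed.

Lemma component_seq x : exists s, [/\ uniq s,
  forall n, n \notin s -> x`_[n] = 0 & x = \sum_(n <- s) x`_[n]].
Proof.
have [/finite_selectionP [_ [s [us s0]]] xE] := component_selection x.
by exists s; split=> //; rewrite {1}xE; apply: fsum_seq.
Qed.

Lemma componentE x (c : int -> R) (s : seq int) : uniq s ->
  (forall n, G n (c n)) -> (forall n, n \notin s -> c n = 0) ->
  x = \sum_(n <- s) c n -> forall n, x`_[n] = c n.
Proof.
move=> us Gc c0 xE n; apply/eqP; rewrite -subr_eq0; apply/eqP.
have [t [ut t0 xE']] := component_seq x.
have [_ [_ indG] _] := grG.
have ust : uniq (undup (s ++ t)) by exact: undup_uniq.
have xE2 : \sum_(n <- undup (s ++ t)) c n = x.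
  rewrite xE -(fsum_seq us c0) (fsum_seq ust) // => k.
  by rewrite mem_undup mem_cat negb_or => /andP[/c0].
have xE3 : \sum_(n <- undup (s ++ t)) x`_[n] = x.
  rewrite [RHS]xE' -(fsum_seq ut t0) (fsum_seq ust) // => k.
  by rewrite mem_undup mem_cat negb_or => /andP[_ /t0].
have d0 k : k \notin undup (s ++ t) -> x`_[k] - c k = 0.
  by rewrite mem_undup mem_cat negb_or => /andP[/c0 -> /t0 ->]; rewrite subrr.
apply: (indG (fun k => x`_[k] - c k)).
  apply/finite_selectionP; split; last by exists (undup (s ++ t)).
  by move=> k; apply: (subgroupB (piece_subgroup k)); first exact: component_in.
by rewrite (fsum_seq ust d0) sumrB xE2 xE3 subrr.
Qed.

Lemma componentB x y i : (x - y)`_[i] = x`_[i] - y`_[i].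
Proof.
have [s [us s0 xE]] := component_seq x; have [t [ut t0 yE]] := component_seq y.
have ust : uniq (undup (s ++ t)) by exact: undup_uniq.
apply: (componentE (c := fun k => x`_[k] - y`_[k]) ust).
- by move=> n; apply: (subgroupB (piece_subgroup n)); exact: component_in.
- move=> n; rewrite mem_undup mem_cat negb_or => /andP[/s0 -> /t0 ->].
  by rewrite subrr.
rewrite sumrB; congr (_ - _).
  rewrite {1}xE -(fsum_seq us s0) (fsum_seq ust) // => k.
  by rewrite mem_undup mem_cat negb_or => /andP[/s0].
rewrite {1}yE -(fsum_seq ut t0) (fsum_seq ust) // => k.
by rewrite mem_undup mem_cat negb_or => /andP[_ /t0].
Qed.

Lemma component0 i : 0`_[i] = 0.
Proof. by rewrite -[in LHS](subrr 0) componentB subrr. Qed.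

Lemma componentD x y i : (x + y)`_[i] = x`_[i] + y`_[i].
Proof.
by rewrite -{1}(opprK y) componentB -(sub0r y) componentB component0 sub0r opprK.
Qed.

Lemma component_sum (I : Type) (s : seq I) (F : I -> R) i :
  (\sum_(j <- s) F j)`_[i] = \sum_(j <- s) (F j)`_[i].
Proof.
exact: (big_morph (fun x => x`_[i]) (fun x y => componentD x y i)
                  (component0 i)).
Qed.

Lemma component_homog x n i : G n x -> x`_[i] = if i == n then x else 0.
Proof.
move=> Gx.
apply: (componentE (c := fun i => if i == n then x else 0) (s := [:: n])) => //.
- move=> k /=; case: eqP => [->|_]; [by []|exact: (subgroup0 (piece_subgroup k))].
- by move=> k; rewrite inE => /negPf ->.
- by rewrite big_seq1 eqxx.
Qed.

Lemma homog_mul n k x y : G n x -> G k y -> G (n + k) (x * y).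
Proof. by case: grG => _ _; apply. Qed.

Lemma component_mull r e x i : G e r -> (r * x)`_[i] = r * x`_[i - e].
Proof.
move=> Gr; have [s [us s0 xE]] := component_seq x.
apply: (componentE (c := fun i => r * x`_[i - e]) (s := map (fun k => k + e) s)).
- by rewrite map_inj_uniq //; apply: addIr.
- by move=> n; have := homog_mul Gr (component_in x (n - e)); rewrite addrC subrK.
- move=> n ns; rewrite s0 ?mulr0 //; apply: contraNN ns => ns.
  by apply/mapP; exists (n - e); rewrite // subrK.
- rewrite big_map {1}xE mulr_sumr.
  by apply: eq_bigr => k _; rewrite addrK.
Qed.

Lemma component_mulr r e x i : G e r -> (x * r)`_[i] = x`_[i - e] * r.
Proof.
move=> Gr; have [s [us s0 xE]] := component_seq x.
apply: (componentE (c := fun i => x`_[i - e] * r) (s := map (fun k => k + e) s)).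
- by rewrite map_inj_uniq //; apply: addIr.
- by move=> n; have := homog_mul (component_in x (n - e)) Gr; rewrite subrK.
- move=> n ns; rewrite s0 ?mul0r //; apply: contraNN ns => ns.
  by apply/mapP; exists (n - e); rewrite // subrK.
- rewrite big_map {1}xE mulr_suml.
  by apply: eq_bigr => k _; rewrite addrK.
Qed.

(** The component of degree [k] of a product is the sum of the products of
    components of degrees [k - j] and [j]; this isolates the situation in which
    only the one with [j = t] survives modulo [A]. *)
Lemma component_mul_mod (A : set R) u g k t : additive_subgroup A ->
  (forall j, j != t -> A (u`_[k - j] * g`_[j])) ->
  A (u`_[k - t] * g`_[t] - (u * g)`_[k]).
Proof.
move=> subA Aj; have [s [us s0 gE]] := component_seq g.
have -> : (u * g)`_[k] = \sum_(j <- s) u`_[k - j] * g`_[j].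
  rewrite {1}gE mulr_sumr component_sum; apply: eq_bigr => j _.
  exact/component_mulr/component_in.
have [ts|nts] := boolP (t \in s).
  rewrite (bigD1_seq t) //= opprD addNKr; apply: subgroupN => //.
  rewrite big_mkcond; apply: subgroup_sum => // j _.
  by case: ifP => [/Aj|_] //; exact: subgroup0.
rewrite (s0 t nts) mulr0 sub0r; apply: subgroupN => //.
apply: subgroup_sum => // j js; apply: Aj.
by apply: contraTneq js => ->.
Qed.

Lemma homog_additive_ind (A : set R) : additive_subgroup A ->
  (forall e r, G e r -> A r) -> forall r, A r.
Proof.
move=> subA Ar r; have [s [_ _ ->]] := component_seq r.
by apply: subgroup_sum => // i _; apply: Ar (component_in r i).
Qed.

(** * Homogeneous ideals and graded primes *)

(** By independence of the [G n], a decomposition of [x] with terms in [I] can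
    only be the one into the components of [x]. *)
Lemma homogeneous_idealP I : homogeneous_ideal G I <->
  two_sided_ideal I /\ forall x i, I x -> I x`_[i].
Proof.
split=> -[idI HI]; split=> //.
  move=> x i; have [<- _] := HI; case=> c.
  case/finite_selectionP => Ic [s [us s0]] ->; rewrite HI.1 (fsum_seq us s0).
  have -> : component G (\sum_(k <- s) c k) i = c i; last exact: (Ic i).1.
  by apply: (componentE us) => // k; case: (Ic k).
split; first apply/seteqP; first split=> x.
- case=> c /finite_selectionP [Ic [s [us s0]]] ->; rewrite (fsum_seq us s0).
  by apply: (subgroup_sum idI.1) => k _; case: (Ic k).
- move=> Ix; have [[_ fx] xE] := component_selection x.
  exists (component G x) => //; split=> // k; split; first exact: HI.
  exact: component_in.
- have [_ [_ indG] _] := grG.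
  by move=> c [Ic fc]; apply: indG; split=> // k; case: (Ic k).
Qed.

(** The two ideals fed to the definition of graded primeness are annihilators
    modulo [P], which avoids describing the ideals generated by [x] and [y]. *)
Lemma graded_prime_homog P n m x y : graded_prime G P -> G n x -> G m y ->
  (forall e r, G e r -> P (x * r * y)) -> P x \/ P y.
Proof.
move=> [/homogeneous_idealP[[sP mulP] compP] primeP] Gx Gy Pxy.
pose J := [set z | forall r, P (x * r * z)].
pose I := [set z | forall w, J w -> P (z * w)].
have idJ : two_sided_ideal J.
  split; first apply: subgroupI.
  - by move=> r; rewrite mulr0; apply: subgroup0.
  - by move=> z w Jz Jw r; rewrite mulrBr; apply: subgroupB.
  - move=> t z Jz; split=> r; first by rewrite mulrA -(mulrA x).
    by rewrite mulrA; case: (mulP t _ (Jz r)).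
have compJ z i : J z -> J z`_[i].
  move=> Jz; apply: homog_additive_ind.
    apply: subgroupI => [|r s]; first by rewrite mulr0 mul0r; apply: subgroup0.
    by rewrite mulrBr mulrBl; apply: subgroupB.
  move=> e r Gr; rewrite -[X in _`_[X]](addrK (n + e)).
  by rewrite -(component_mull _ _ (homog_mul Gx Gr)); apply: compP.
have idI : two_sided_ideal I.
  split; first apply: subgroupI.
  - by move=> w _; rewrite mul0r; apply: subgroup0.
  - by move=> z w Iz Iw v Jv; rewrite mulrBl; apply: subgroupB; auto.
  - move=> t z Iz; split=> w Jw; rewrite -mulrA.
      by case: (mulP t _ (Iz w Jw)).
    by apply: Iz; case: (idJ.2 t w Jw).
have compI z i : I z -> I z`_[i].
  move=> Iz w Jw; have [s [_ _ ->]] := component_seq w; rewrite mulr_sumr.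
  apply: subgroup_sum => // k _; rewrite -[X in _`_[X] * _](addrK k).
  rewrite -(component_mulr _ _ (component_in w k)).
  by apply/compP/Iz/compJ.
have [||z [s sIJ ->]|IP|JP] := primeP I J.
- by apply/homogeneous_idealP.
- by apply/homogeneous_idealP.
- by apply: subgroup_sum => // v /sIJ[Iv Jv]; apply: Iv.
- by left; apply: IP => w Jw; rewrite -(mulr1 x); apply: Jw.
right; apply: JP; apply: homog_additive_ind => //.
apply: subgroupI => [|r s]; first by rewrite mulr0 mul0r; apply: subgroup0.
by rewrite mulrBr mulrBl; apply: subgroupB.
Qed.

Lemma graded_prime_witness P n m x y : graded_prime G P -> G n x -> G m y ->
  ~ P x -> ~ P y -> exists e r, G e r /\ ~ P (x * r * y).
Proof.
move=> primeP Gx Gy Px Py; apply: contrapT => Pxy.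
have [e r Gr|//|//] := graded_prime_homog primeP Gx Gy.
by apply: contrapT => Pr; apply: Pxy; exists e, r.
Qed.

(** * Supports *)

Definition supported_in p (n : nat) x :=
  forall i, ~~ (p <= i <= p + n%:Z) -> x`_[i] = 0.

Lemma supported_in_ex x : exists p (n : nat), supported_in p n x.
Proof.
have [s [_ s0 _]] := component_seq x.
have [N sN] : exists N : nat, forall i, i \in s -> - N%:Z <= i <= N%:Z.
  elim: s {s0} => [|k s [N sN]]; first by exists 0%N.
  exists (N + `|k|)%N => i; rewrite inE => /orP[/eqP ->|/sN]; lia.
exists (- N%:Z), (N + N)%N => i iN; apply: s0.
by apply: contraNN iN => /sN; lia.
Qed.

Lemma components_eq0 x : (forall i, x`_[i] = 0) -> x = 0.
Proof.
by move=> x0; have [s [_ _ ->]] := component_seq x; rewrite big1.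
Qed.

Lemma supported_in0 p x : supported_in p 0 x -> G p x.
Proof.
move=> supx; suff -> : x = x`_[p] by apply: component_in.
apply/eqP; rewrite -subr_eq0; apply/eqP/components_eq0 => i.
rewrite componentB (component_homog i (component_in x p)).
by case: eqP => [->|ip]; rewrite ?subrr // subr0 supx //; lia.
Qed.

(** * Maximal ideals containing no nonzero homogeneous ideal *)

Section Maximal.
Variable M : set R.
Hypothesis maxM : maximal_ideal M.
Hypothesis coreM : largest_homogeneous_ideal_in G M [set 0].

Let idM : two_sided_ideal M. Proof. by case: maxM. Qed.
Let sM : additive_subgroup M. Proof. by case: idM. Qed.

Lemma maximal_not1 : ~ M 1.
Proof. by move=> M1; have [_ MT _] := maxM; apply/MT/ideal_proper_1. Qed.

(** The elements all of whose components lie in [M] form a homogeneous ideal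
    inside [M], hence only [0]; a homogeneous element of [M] is one of them. *)
Lemma maximal_homog0 n x : G n x -> M x -> x = 0.
Proof.
move=> Gx Mx; have [_ _ maxH] := coreM.
pose K := [set z | forall i, M z`_[i]].
have idK : two_sided_ideal K.
  split; first apply: subgroupI.
  - by move=> i; rewrite component0; apply: subgroup0.
  - by move=> z w Kz Kw i; rewrite componentB; apply: subgroupB.
  - move=> t z Kz; split=> i; have [s [_ _ zE]] := component_seq t.
      rewrite zE mulr_suml component_sum; apply: subgroup_sum => // k _.
      rewrite (component_mull _ _ (component_in t k)).
      by case: (idM.2 t`_[k] _ (Kz (i - k))).
    rewrite zE mulr_sumr component_sum; apply: subgroup_sum => // k _.
    rewrite (component_mulr _ _ (component_in t k)).
    by case: (idM.2 t`_[k] _ (Kz (i - k))).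
have component_in_M z i k : M z`_[i] -> M (z`_[i])`_[k].
  rewrite (component_homog k (component_in z i)).
  by case: eqP => // _ _; apply: subgroup0.
apply: (maxH K).
- by apply/homogeneous_idealP; split=> // z i Kz k; apply: component_in_M.
- move=> z Kz; have [s [_ _ ->]] := component_seq z.
  exact: subgroup_sum.
- move=> i; rewrite (component_homog i Gx); case: eqP => // _.
  exact: subgroup0.
Qed.

(** Otherwise [I + M = M], and [I] is a homogeneous ideal contained in [M]. *)
Lemma maximal_comaximal I : homogeneous_ideal G I -> I <> [set 0] ->
  exists f, M f /\ I (1 - f).
Proof.
move=> homI I0; have [_ _ maxH] := coreM.
have [idI _] := homI; have [_ _ maxM'] := maxM.
pose S := [set z | exists f, M f /\ I (z - f)].
have idS : two_sided_ideal S.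
  split; first apply: subgroupI.
  - by exists 0; rewrite subrr; split; apply: subgroup0 => //; case: idI.
  - move=> z w [f [Mf If]] [g [Mg Ig]]; exists (f - g); split.
      exact: subgroupB.
    by rewrite opprD addrACA -opprD; apply: subgroupB => //; case: idI.
  - move=> t z [f [Mf If]].
    have [] := idM.2 t f Mf; have [] := idI.2 t _ If; rewrite mulrBr mulrBl.
    by move=> *; split; [exists (t * f)|exists (f * t)].
have MS : M `<=` S.
  move=> z Mz; exists z; rewrite subrr; split=> //.
  by apply: subgroup0; case: idI.
have [SM|ST] := maxM' S idS MS; last by have : S 1 by rewrite ST.
have IM : I `<=` M.
  move=> z Iz; rewrite -SM; exists 0; rewrite subr0; split=> //.
  exact: subgroup0.
case: I0; apply/seteqP; split; first exact: maxH.
by move=> _ ->; apply: subgroup0; case: idI.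
Qed.

(** If [1 - f] is in [I] and [1 - g] in [J], with [f] and [g] in [M], then
    [(1 - f) * (1 - g)] is congruent to [1] modulo [M], so it is not [0]. *)
Lemma graded_prime0 : graded_prime G [set 0].
Proof.
have [hom0 _ _] := coreM.
split=> // I J homI homJ IJ0.
have [I0|I0] := pselect (I = [set 0]); first by left; rewrite I0.
have [J0|J0] := pselect (J = [set 0]); first by right; rewrite J0.
have [f [Mf If]] := maximal_comaximal homI I0.
have [g [Mg Jg]] := maximal_comaximal homJ J0.
case: maximal_not1; have : (1 - f) * (1 - g) = 0.
  apply: IJ0; exists [:: (1 - f, 1 - g)]; last by rewrite big_seq1.
  by move=> v; rewrite inE => /eqP ->.
move/eqP; rewrite mulrBl mul1r subr_eq0 => /eqP gE.
rewrite -(subrK g 1) gE; apply: subgroupD => //.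
by have [_] := idM.2 (1 - g) f Mf.
Qed.

Definition shortest_in p (n : nat) m :=
  [/\ M m, m <> 0, supported_in p n m &
      forall x q (k : nat), M x -> supported_in q k x -> (k < n)%N -> x = 0].

Lemma shortest_in_ex : M <> [set 0] -> exists p (n : nat) m, shortest_in p n m.
Proof.
move=> M0.
have [m [Mm m0]] : exists m, M m /\ m <> 0.
  apply: contrapT => noM; apply: M0; apply/seteqP; split=> [z Mz|_ ->].
    by apply: contrapT => z0; apply: noM; exists z.
  exact: subgroup0.
pose short (n : nat) := `[< exists p m, [/\ M m, m <> 0 & supported_in p n m] >].
have ex_short : exists n : nat, short n.
  by have [p [n supm]] := supported_in_ex m; exists n; apply/asboolP; exists p, m.
case: (ex_minnP ex_short) => n /asboolP[p [m' [Mm' m'0 supm']]] min_n.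
exists p, n, m'; split=> // x q k Mx supx; rewrite ltnNge => /negP kn.
by apply: contrapT => x0; apply: kn; apply/min_n/asboolP; exists q, x.
Qed.

Section Shortest.
Variables (p : int) (n : nat) (m : R).
Hypothesis shortm : shortest_in p n m.

Let Mm : M m. Proof. by case: shortm. Qed.
Let suppm : supported_in p n m. Proof. by case: shortm. Qed.
Let minM x q (k : nat) : M x -> supported_in q k x -> (k < n)%N -> x = 0.
Proof. by case: shortm => _ _ _; apply. Qed.

Local Notation a := m`_[p + n%:Z].
Local Notation b := m`_[p].

Let Ga : G (p + n%:Z) a := component_in _ _.
Let Gb : G p b := component_in _ _.

Lemma shortest_gt0 : (0 < n)%N.
Proof.
rewrite lt0n; apply/eqP => n0; have [_ m0 _ _] := shortm.
have supp0 := suppm; rewrite n0 in supp0.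
by apply/m0/(maximal_homog0 (supported_in0 supp0)).
Qed.

(** If an extreme component of [m] vanished, [m] would be supported in an
    interval of length [n - 1]. *)
Lemma shortest_top_neq0 : a <> 0.
Proof.
move=> a0; have [_ m0 _ _] := shortm; have n_gt0 := shortest_gt0.
apply/m0/(minM (q := p) (k := n.-1) Mm); last by lia.
move=> i ip; have [->//|in_] := eqVneq i (p + n%:Z).
by apply: suppm; lia.
Qed.

Lemma shortest_bottom_neq0 : b <> 0.
Proof.
move=> b0; have [_ m0 _ _] := shortm; have n_gt0 := shortest_gt0.
apply/m0/(minM (q := p + 1) (k := n.-1) Mm); last by lia.
move=> i ip; have [->//|in_] := eqVneq i p.
by apply: suppm; lia.
Qed.

(** Both sides have the same leading component [a * r * a], so their difference
    is an element of [M] shorter than [m]. *)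
Lemma shortest_top_comm e r : G e r -> a * r * m = m * r * a.
Proof.
move=> Gr; apply/eqP; rewrite -subr_eq0; apply/eqP.
have n_gt0 := shortest_gt0.
apply: (minM (q := 2 * p + n%:Z + e) (k := n.-1)); last by lia.
  apply: subgroupB => //; first by case: (idM.2 (a * r) m Mm).
  by rewrite -mulrA; case: (idM.2 (r * a) m Mm).
move=> i isup; rewrite componentB (component_mull _ _ (homog_mul Ga Gr)).
rewrite -(mulrA m) (component_mulr _ _ (homog_mul Gr Ga)).
have [->|itop] := eqVneq i (p + n%:Z + e + (p + n%:Z)).
  rewrite (_ : _ + e + _ - _ = p + n%:Z); last by lia.
  by rewrite (_ : _ + e + _ - _ = p + n%:Z) ?mulrA ?subrr //; lia.
by rewrite ![m`_[i - _]]suppm ?mulr0 ?mul0r ?subrr //; lia.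
Qed.

(** Division by [m] of an element [f] of [M], carried out up to left
    multiplication by [h].  As [a] need not be regular, [x] keeps track of what
    has to survive: each step of the division chooses a multiplier that does
    not push [x] into [P]. *)
Lemma shortest_division P : graded_prime G P -> ~ P a ->
  forall (k : nat) q f, M f -> supported_in q k f ->
  forall d x, G d x -> ~ P x ->
  exists d' h g, [/\ G d' h, ~ P (h * x) &
    forall e r, G e r -> a * r * h * f = m * r * g].
Proof.
move=> primeP Pa; have n_gt0 := shortest_gt0; elim=> [|k IHk] q f.
  move=> Mf supf d x Gx Px; have -> := minM Mf supf n_gt0.
  have [e [r [Gr Par]]] := graded_prime_witness primeP Ga Gx Pa Px.
  exists (p + n%:Z + e), (a * r), 0; split=> //; first exact: homog_mul.
  by move=> e' r' _; rewrite !mulr0.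
move=> Mf supf d x Gx Px.
have [e [r [Gr Par]]] := graded_prime_witness primeP Ga Gx Pa Px.
have Gar := homog_mul Ga Gr.
pose c := f`_[q + k.+1%:Z]; have Gc : G _ c := component_in f (q + k.+1%:Z).
pose f' := a * r * f - m * r * c.
have Mf' : M f'.
  apply: subgroupB => //; first by case: (idM.2 (a * r) f Mf).
  by rewrite -mulrA; case: (idM.2 (r * c) m Mm).
(* The components in the top degree of both terms are [a * r * c]; [m * r * c]
   does not reach below [a * r * f] because [f], unless it is [0], is no
   shorter than [m]. *)
have supf' : supported_in (p + n%:Z + e + q) k f'.
  move=> i isup; rewrite componentB (component_mull _ _ Gar).
  rewrite -(mulrA m) (component_mulr _ _ (homog_mul Gr Gc)).
  have [kn|nk] := ltnP k.+1 n.
    have f0 := minM Mf supf kn.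
    by rewrite /c f0 !component0 !mulr0 subrr.
  have [->|itop] := eqVneq i (p + n%:Z + e + (q + k.+1%:Z)).
    rewrite (_ : _ + e + _ - _ = q + k.+1%:Z); last by lia.
    rewrite (_ : _ + e + _ - _ = p + n%:Z); last by lia.
    by rewrite mulrA subrr.
  by rewrite [f`_[i - _]]supf ?[m`_[i - _]]suppm ?mulr0 ?mul0r ?subrr //; lia.
have [d' [h [g [Gh Phx hg]]]] := IHk _ _ Mf' supf' _ _ (homog_mul Gar Gx) Par.
exists (d' + (p + n%:Z + e)), (h * (a * r)), (h * a * r * c + g); split.
- exact: homog_mul.
- by rewrite -mulrA.
move=> e' r' Gr'; rewrite mulrDr -(hg e' r' Gr').
have := shortest_top_comm (homog_mul Gr' Gh) => comm.
rewrite /f' mulrBr !mulrA in comm *.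
by rewrite comm [RHS]addrC subrK.
Qed.

(** With [f] congruent to [1] modulo [P], division by [m] makes [m * r * g]
    congruent to [a * r * h], a homogeneous element; comparing degrees at both
    ends would put the lowest degree of [g] modulo [P] above its highest one. *)
Lemma shortest_in_prime P : graded_prime G P -> P <> [set 0] -> P a \/ P b.
Proof.
move=> primeP P0; have [Pa|Pa] := pselect (P a); first by left.
have [Pb|Pb] := pselect (P b); first by right.
have n_gt0 := shortest_gt0.
have [homP _] := primeP; have [[sP mulP] compP] := (homogeneous_idealP _).1 homP.
have [f [Mf Pf]] := maximal_comaximal homP P0.
have [q [k supf]] := supported_in_ex f.
have [d [h [g [Gh Pha hg]]]] := shortest_division primeP Pa Mf supf Ga Pa.
have Ph : ~ P h by move=> Ph; apply: Pha; case: (mulP a h Ph).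
have congr e r : G e r -> P (a * r * h - m * r * g).
  move=> Gr; rewrite -(hg e r Gr) -{1}(mulr1 (a * r * h)) -mulrBr.
  by case: (mulP (a * r * h) _ Pf).
have comp_out e r i : G e r -> i != p + n%:Z + e + d -> P (m * r * g)`_[i].
  move=> Gr ine; have := compP _ i (congr e r Gr).
  rewrite componentB (component_homog _ (homog_mul (homog_mul Ga Gr) Gh)).
  by rewrite (negPf ine) => /(subgroupN sP); rewrite sub0r opprK.
have [s [us s0 gE]] := component_seq g.
have Pmul_l x y : P y -> P (x * y) by move=> Py; case: (mulP x y Py).
have ex_g : exists t, ~ P g`_[t].
  apply: contrapT => noP.
  have [e [r [Gr Par]]] := graded_prime_witness primeP Ga Gh Pa Ph.
  apply: Par; rewrite -(subrK (m * r * g) (a * r * h)).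
  apply: subgroupD => //; first exact: congr Gr.
  apply: Pmul_l; rewrite gE; apply: subgroup_sum => // t _.
  by apply: contrapT => Pgt; apply: noP; exists t.
(* [u] is either extreme degree of [m], and [t] the matching extreme degree of
   [g] modulo [P]. *)
have extreme (u t : int) : ~ P m`_[u] -> ~ P g`_[t] ->
    (forall j, j != t -> m`_[u + t - j] = 0 \/ P g`_[j]) ->
  u + t = p + n%:Z + d.
  move=> Pc Pgt off.
  have [e [r [Gr Pcr]]] := graded_prime_witness primeP (component_in m u)
    (component_in g t) Pc Pgt.
  apply/eqP; apply: contrapT => /negP une; apply: Pcr.
  have rE i : (m * r)`_[i + e] = m`_[i] * r.
    by rewrite (component_mulr _ _ Gr) addrK.
  have uE j : u + e + t - j = u + t - j + e by lia.
  have : P ((m * r)`_[u + e + t - t] * g`_[t] - (m * r * g)`_[u + e + t]).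
    apply: component_mul_mod => // j jt; rewrite uE rE.
    by case: (off j jt) => [->|/Pmul_l//]; rewrite !mul0r; apply: subgroup0.
  rewrite uE rE addrK => Pdiff.
  rewrite -(subrK (m * r * g)`_[u + e + t] (_ * _)).
  by apply: subgroupD => //; apply: (comp_out e) => //; lia.
have g_in_s j : ~ P g`_[j] -> j \in s.
  by apply: contra_notT => /s0 ->; apply: subgroup0.
have [t [t' [Pt Pt' tt']]] := finite_extremes ex_g g_in_s.
have top : p + n%:Z + t = p + n%:Z + d.
  apply: extreme => // j jt; have [Pgj|/tt' jtt'] := pselect (P g`_[j]).
    by right.
  by left; apply: suppm; lia.
have bottom : p + t' = p + n%:Z + d.
  apply: extreme => // j jt; have [Pgj|/tt' jtt'] := pselect (P g`_[j]).
    by right.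
  by left; apply: suppm; lia.
by have := tt' _ Pt; lia.
Qed.

End Shortest.

End Maximal.

End Components.

Theorem theorem2 (R : pzRingType) (G : int -> set R) (M : set R) :
  Z_grading G ->
  maximal_ideal M ->
  largest_homogeneous_ideal_in G M [set 0] ->
  graded_pseudoradical G <> [set 0].
Proof.
move=> grG maxM coreM prad0.
suff [z z0 zP] : exists2 z, z <> 0 &
    forall P, graded_prime G P -> P <> [set 0] -> P z.
  by apply: z0; rewrite -[_ = _]/([set 0] z) -prad0 => P [primeP P0]; apply: zP.
have [M0|M0] := pselect (M = [set 0]).
  exists 1; first by move=> R0; apply: (maximal_not1 maxM); rewrite M0.
  move=> P [homP _] P0; have [f [+ Pf]] := maximal_comaximal maxM coreM homP P0.
  by rewrite M0 => f0; move: Pf; rewrite f0 subr0.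
have [p [n [m shortm]]] := shortest_in_ex grG maxM M0.
have [e [r [Gr arb]]] := graded_prime_witness grG (graded_prime0 maxM coreM)
  (component_in grG m (p + n%:Z)) (component_in grG m p)
  (shortest_top_neq0 grG maxM coreM shortm)
  (shortest_bottom_neq0 grG maxM coreM shortm).
exists (component G m (p + n%:Z) * r * component G m p) => // P primeP P0.
have [/(homogeneous_idealP grG)[[_ mulP] _] _] := primeP.
have [Pa|Pb] := shortest_in_prime grG maxM coreM shortm primeP P0.
  by rewrite -mulrA; case: (mulP (r * component G m p) _ Pa).
by case: (mulP (component G m (p + n%:Z) * r) _ Pb).
Qed.
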